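(* For every integer $n\ge 1$, $$v_5(\mathbf G_n(5))=\begin{cases}0,& n\equiv 0\pmod 4,\\ 1+v_5(n),& n\equiv 1\pmod 4,\\ 2+v_5(n)+v_5(n-1),& n\equiv 2\pmod 4,\\ 3+v_5(n)+v_5(n-1)+v_5(n-2),& n\equiv 3\pmod 4.\end{cases}$$ Equivalently, if $n=4Q+r$ with $Q$ an integer and $0\le r\le 3$, then $$v_5(\mathbf G_n(5))=r+v_5\binom nr.$$
   Context: Here $i^2=-1$ and $\mathbf G_n(5)=\sum_{a=1}^{4}\sum_{b=1}^{4}(a+bi)^n\in\mathbb Z[i]$. For $x+yi\in\mathbb Z[i]$, $v_5(x+yi)=\min\{v_5(x),v_5(y)\}$, where $v_5$ on integers is the usual $5$-adic valuation ($v_5(0)=\infty$). *)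

(* Defs.v *)
From HB Require Import structures.
From mathcomp Require Import all_boot all_order all_algebra.
From mathcomp Require Import complex.
From mathcomp Require Import constructive_ereal.

Set Implicit Arguments.
Unset Strict Implicit.
Unset Printing Implicit Defensive.

Import Order.TTheory GRing.Theory Num.Theory.
Local Open Scope ring_scope.

(* Z[i], as pairs x +i* y of integers. The library puts an additive group
   structure on complex R for every ring R, but a multiplication only when R
   is a field. The multiplication below is the library's
   (a + b i)(c + d i) = (a c - b d) + (a d + b c) i, and an alias is needed
   because the ring instance on complex is reserved for fields. *)
Definition gaussint : Type := complex int.

HB.instance Definition _ := GRing.Zmodule.on gaussint.

Definition gone : gaussint := Complex 1 0.
Definition gmul (x y : gaussint) : gaussint := ComplexField.mulc x y.

Lemma gmulA : associative gmul.
Proof. exact: ComplexField.mulcA. Qed.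

Lemma gmulC : commutative gmul.
Proof. exact: ComplexField.mulcC. Qed.

Lemma gmul1 : left_id gone gmul.
Proof. by case=> a b; rewrite /gmul /= !mul1r !mul0r subr0 addr0. Qed.

Lemma gmulDl : left_distributive gmul +%R.
Proof.
move=> [a b] [c d] [e f].
change (Complex ((a + c) * e - (b + d) * f) ((a + c) * f + (b + d) * e)
  = Complex ((a * e - b * f) + (c * e - d * f))
            ((a * f + b * e) + (c * f + d * e))).
by rewrite !mulrDl opprD addrACA [X in Complex _ X = _]addrACA.
Qed.

Lemma gone_neq0 : gone != 0.
Proof. by []. Qed.

HB.instance Definition _ :=
  GRing.Zmodule_isComNzRing.Build gaussint gmulA gmulC gmul1 gmulDl gone_neq0.

(* \bar int is int extended with -oo and +oo; -oo is never a value. *)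
Definition vp (p : nat) (x : int) : \bar int :=
  if x == 0 then +oo%E else ((logn p `|x|%N)%:Z)%:E.

Definition gvp (p : nat) (z : gaussint) : \bar int :=
  Order.min (vp p (complex.Re z)) (vp p (complex.Im z)).

Definition G5 (n : nat) : gaussint :=
  \sum_(1 <= a < 5) \sum_(1 <= b < 5)
    (Complex (a%:Z) (b%:Z) : gaussint) ^+ n.

(* Main.v *)
From HB Require Import structures.
Require Import Defs.
From mathcomp Require Import all_boot all_order all_algebra.
From mathcomp Require Import complex constructive_ereal.
From mathcomp Require Import zify ring.

Import Order.TTheory GRing.Theory Num.Theory.
Local Open Scope ring_scope.

(** Doubling and centring makes the index set symmetric. For z = a + b i with
    1 <= a, b <= 4, one has 2 z = w + 5 (1 + i), where w runs over the sixteen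
    points with both coordinates in {-3, -1, 1, 3}. This square is stable under
    multiplication by i, so its power sum S_k satisfies i^k S_k = S_k and
    vanishes unless 4 divides k ([psum_eq0]). Expanding by the binomial formula
    ([G5_expand]),

      2^n G_n = sum over j <= n of C(n, j) 5^j (1 + i)^j S_(n - j),

    and only the indices j congruent to n modulo 4 contribute.

    Let r = n mod 4. The term j = r has valuation exactly r + v_5(C(n, r)),
    because (1 + i)^r S_(4 Q) is not divisible by 5: its image under the ring
    morphism Z[i] -> F_5 sending i to 2 is nonzero. Indeed 2 + 1 = 3 is
    invertible, and by Fermat S_(4 Q) maps to the number of points w with
    nonzero image, which is 12 (or to 16 when Q = 0) ([ev2_psum]).

    Every other term has j >= r + 4 and a larger valuation. In
    C(n, j) C(j, r) = C(n, r) C(n - r, j - r) the factor C(j, r) is smaller than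
    5^(j - r), so passing from C(n, r) to C(n, j) loses fewer than j - r
    factors 5, whereas 5^j gains j - r of them over 5^r ([dvdn_tail_term]).
    As 2^n is prime to 5, this gives the valuation of G_n ([gvp_G5]). The case
    formulas follow because r! is prime to 5, so that C(n, r) and
    n (n - 1) ... (n - r + 1) have the same valuation. *)

(** * Divisibility of Gaussian integers by natural numbers *)

Lemma gaussint_mulE (a b c d : int) :
  (Complex a b : gaussint) * Complex c d
  = Complex (a * c - b * d) (a * d + b * c).
Proof. by []. Qed.

Lemma gaussint_addE (a b c d : int) :
  (Complex a b : gaussint) + Complex c d = Complex (a + c) (b + d).
Proof. by []. Qed.

Lemma gaussint_mulrnE (a b : int) m :
  (Complex a b : gaussint) *+ m = Complex (m%:Z * a) (m%:Z * b).
Proof.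
elim: m => [|m IHm]; first by rewrite mulr0n !mul0r.
by rewrite mulrS IHm gaussint_addE; congr Complex; ring.
Qed.

Definition gdvd (m : nat) (z : gaussint) : bool :=
  (m%:Z %| complex.Re z)%Z && (m%:Z %| complex.Im z)%Z.

Lemma gdvd_mulrn d m z : (d %| m)%N -> gdvd d (z *+ m).
Proof.
case: z => x y d_m; rewrite gaussint_mulrnE /gdvd /=.
by rewrite !dvdz_mulr.
Qed.

Lemma gdvd_sum d I (s : seq I) (P : pred I) (F : I -> gaussint) :
  (forall i, P i -> gdvd d (F i)) -> gdvd d (\sum_(i <- s | P i) F i).
Proof.
move=> dF; apply: (big_ind (gdvd d)) => //.
  by rewrite /gdvd /= !dvdz0.
move=> [a b] [a' b'] /andP[/= da db] /andP[/= da' db'].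
by rewrite /gdvd /= !rpredD.
Qed.

Lemma gdvd_dvdn d d' z : (d %| d')%N -> gdvd d' z -> gdvd d z.
Proof.
move=> dd' /andP[zr zi].
by rewrite /gdvd !(dvdz_trans _ zr, dvdz_trans _ zi).
Qed.

Lemma gdvd_addl d y z : gdvd d z -> gdvd d (y + z) = gdvd d y.
Proof.
case: y z => [a b] [a' b'] /andP[/= da db].
by rewrite gaussint_addE /gdvd /= !rpredDr.
Qed.

Lemma gdvd_pmul2l m d z : (0 < m)%N -> gdvd (m * d) (z *+ m) = gdvd d z.
Proof.
case: z => x y m0; rewrite gaussint_mulrnE /gdvd /= PoszM.
by rewrite !dvdz_mul2l //; lia.
Qed.

Lemma gdvd_Gauss m d z : coprime d m -> gdvd d (z *+ m) = gdvd d z.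
Proof.
case: z => x y co; rewrite gaussint_mulrnE /gdvd /=.
by rewrite !Gauss_dvdzr.
Qed.

Lemma le_vp p (x : int) k : prime p ->
  (k%:Z%:E <= vp p x)%E = (p ^ k %| `|x|)%N.
Proof.
move=> p_pr; rewrite /vp; case: eqP => [->|/eqP x0].
  by rewrite leey dvdn0.
by rewrite lee_fin lez_nat pfactor_dvdn // absz_gt0.
Qed.

Lemma le_gvp p z k : prime p -> (k%:Z%:E <= gvp p z)%E = gdvd (p ^ k) z.
Proof. by move=> p_pr; rewrite /gvp le_min !le_vp. Qed.

Lemma gvp_eq p z k :
  prime p -> gdvd (p ^ k) z -> ~~ gdvd (p ^ k.+1) z -> gvp p z = k%:Z%:E.
Proof.
move=> p_pr; rewrite -!le_gvp //; case: (gvp p z) => [v| |] //.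
by rewrite !lee_fin => kv; rewrite -ltNge => vk; congr (_%:E); lia.
Qed.

(** * Power sums over the centred square *)

Definition gi : gaussint := Complex 0 1.

(** The point 2 z - 5 (1 + i) for z = (a + 1) + (b + 1) i. *)
Definition centered (a b : 'I_4) : gaussint :=
  Complex (2 * a%:Z - 3) (2 * b%:Z - 3).

Definition psum (k : nat) : gaussint := \sum_a \sum_b centered a b ^+ k.

Lemma gi_mul_centered a b : gi * centered a b = centered (rev_ord b) a.
Proof.
rewrite gaussint_mulE /centered /=; congr (Complex _ _); have := ltn_ord b; lia.
Qed.

(** Multiplication by i permutes the points being summed. *)
Lemma gi_exp_mul_psum k : gi ^+ k * psum k = psum k.
Proof.
rewrite /psum [RHS](reindex_inj rev_ord_inj) /= exchange_big /= mulr_sumr.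
apply: eq_bigr => a _; rewrite mulr_sumr; apply: eq_bigr => b _.
by rewrite -exprMn gi_mul_centered.
Qed.

(** S_k is fixed by i^k, and i^k differs from 1. *)
Lemma psum_eq0 k : ~~ (4 %| k)%N -> psum k = 0.
Proof.
move=> k4.
have gik : gi ^+ k = gi ^+ (k %% 4).
  by rewrite {1}(divn_eq k 4) exprD mulnC exprM (_ : gi ^+ 4 = 1) // expr1n mul1r.
suff: psum k *+ 2 = 0.
  case: (psum k) => x y; rewrite gaussint_mulrnE => -[hx hy].
  by congr Complex; lia.
(* 1 - i^k divides 2, which turns (1 - i^k) S_k = 0 into 2 S_k = 0. *)
have [c c2] : exists c, c * (1 - gi ^+ k) = 2%:R.
  rewrite gik; have: (0 < k %% 4 < 4)%N by rewrite lt0n ltn_mod andbT.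
  case: (k %% 4)%N => [|[|[|[|]]]] // _.
  - by exists (Complex 1 1).
  - by exists (Complex 1 0).
  - by exists (Complex 1 (-1)).
by rewrite -mulr_natl -c2 -mulrA mulrBl mul1r gi_exp_mul_psum subrr mulr0.
Qed.

(** * Reduction modulo a prime above 5 *)

(** The residue map of a prime above 5: i goes to 2, a square root of -1
    modulo 5. *)
Definition ev2 (z : gaussint) : 'F_5 :=
  (complex.Re z)%:~R + 2%:R * (complex.Im z)%:~R.

Lemma ev2_is_additive : additive ev2.
Proof.
by move=> [a b] [c d]; rewrite /ev2 /= !rmorphB /=; ring.
Qed.

Lemma ev2_is_monoid_morphism : monoid_morphism ev2.
Proof.
split=> [|[a b] [c d]]; first by apply/eqP.
rewrite gaussint_mulE /ev2 /= !(rmorphB, rmorphD, rmorphM) /=.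
set A := a%:~R; set B := b%:~R; set C := c%:~R; set D := d%:~R.
(* The only relation beyond the ring axioms is 2 * 2 = -1. *)
have m1 : 4%:R = -1 :> 'F_5 by apply/eqP.
transitivity (A * C + 4%:R * B * D + 2%:R * (A * D + B * C)); last by ring.
by rewrite m1; ring.
Qed.

HB.instance Definition _ := GRing.isZmodMorphism.Build _ _ ev2 ev2_is_additive.
HB.instance Definition _ :=
  GRing.isMonoidMorphism.Build _ _ ev2 ev2_is_monoid_morphism.

Lemma gdvd5_ev2 z : gdvd 5 z -> ev2 z = 0.
Proof.
case: z => x y /andP[/= /dvdzP[x' ->] /dvdzP[y' ->]].
have F5 : 5%:R = 0 :> 'F_5 by apply/eqP.
by rewrite /ev2 /= !rmorphM /= -[5%:~R]/(5%:R) F5 !mulr0 addr0.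
Qed.

Lemma F5_exp4 (x : 'F_5) Q : x ^+ (4 * Q.+1) = (x != 0)%:R.
Proof.
have x4 : x ^+ 4 = (x != 0)%:R.
  by apply/eqP; case: x => [[|[|[|[|[|]]]]] ] //.
by rewrite exprM x4; case: eqP => _; rewrite ?expr0n ?expr1n.
Qed.

(** By Fermat the image counts the points w whose residue is nonzero: 12 of the
    16 points, or all of them, with 0^0 = 1, when Q = 0. Neither 12 nor 16 is a
    multiple of 5. *)
Lemma ev2_psum Q : ev2 (psum (4 * Q)) != 0.
Proof.
rewrite /psum rmorph_sum.
under eq_bigr do rewrite rmorph_sum.
under eq_bigr do under eq_bigr do rewrite rmorphXn /=.
case: Q => [|Q].
  by rewrite !big_ord_recl !big_ord0 !expr0.
under eq_bigr do under eq_bigr do rewrite F5_exp4.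
by rewrite !big_ord_recl !big_ord0.
Qed.

(** * Binomial expansion around the centre *)

Definition diag : gaussint := Complex 1 1.

(** Expand (2 z)^n = (w + 5 (1 + i))^n and sum over z. *)
Lemma G5_expand n :
  G5 n *+ 2 ^ n
  = \sum_(j < n.+1) (psum (n - j) * diag ^+ j) *+ (5 ^ j * 'C(n, j)).
Proof.
rewrite /G5 big_add1 big_mkord.
under eq_bigr do rewrite big_add1 big_mkord.
rewrite -mulr_natl natrX mulr_sumr.
transitivity (\sum_(a < 4) \sum_(b < 4) \sum_(j < n.+1)
   (centered a b ^+ (n - j) * diag ^+ j) *+ (5 ^ j * 'C(n, j)) ).
  apply: eq_bigr => a _; rewrite mulr_sumr; apply: eq_bigr => b _.
  rewrite -exprMn mulr_natl.
  have -> : (Complex a.+1%:Z b.+1%:Z : gaussint) *+ 2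
    = centered a b + diag *+ 5.
    rewrite /diag !gaussint_mulrnE gaussint_addE.
    by congr Complex; rewrite ?intS; ring.
  rewrite exprDn; apply: eq_bigr => j _.
  by rewrite exprMn_n mulrnAr -mulrnA.
under eq_bigr do rewrite exchange_big /=.
rewrite exchange_big /=; apply: eq_bigr => j _.
rewrite /psum mulr_suml -sumrMnl; apply: eq_bigr => a _.
by rewrite mulr_suml -sumrMnl.
Qed.

(** * The terms beyond the leading one *)

(** Both sides count pairs of an r-subset of a j-subset of n elements. *)
Lemma bin_mul_bin n j r : (r <= j <= n)%N ->
  ('C(n, j) * 'C(j, r) = 'C(n, r) * 'C(n - r, j - r))%N.
Proof.
case/andP=> rj jn.
have pos : (0 < r`! * (j - r)`! * (n - j)`!)%N by rewrite !muln_gt0 !fact_gt0.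
apply/eqP; rewrite -(eqn_pmul2r pos); apply/eqP.
have e1 := bin_fact jn; have e2 := bin_fact rj.
have e3 := bin_fact (leq_trans rj jn).
have e4 : (j - r <= n - r)%N by lia.
have {e4} := bin_fact e4; rewrite (_ : n - r - (j - r) = n - j)%N; last by lia.
move=> e4; transitivity (n`!)%N.
  by rewrite -e1 -e2; ring.
by rewrite -e3 -e4; ring.
Qed.

Lemma bin_le_exp2 n m : ('C(n, m) <= 2 ^ n)%N.
Proof.
have [mn|/bin_small->//] := leqP m n.
rewrite -[2%N]/(1 + 1)%N expnDn (bigD1 (Ordinal (mn : m < n.+1)%N)) //=.
by rewrite !exp1n !muln1 leq_addr.
Qed.

Lemma bin_lt_exp5 j r : (r <= 3)%N -> (r + 4 <= j)%N ->
  ('C(j, r) < 5 ^ (j - r))%N.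
Proof.
move=> r3 rj; have -> : j = (r + 4 + (j - (r + 4)))%N by lia.
move: (j - (r + 4))%N => d.
(* The crude bound suffices: 2^(r + 4 + d) <= 128 * 2^d < 625 * 5^d. *)
apply: leq_ltn_trans (bin_le_exp2 _ _) _.
have -> : (r + 4 + d - r = 4 + d)%N by lia.
rewrite !expnD -mulnA; apply: (@leq_ltn_trans (8 * (2 ^ 4 * 2 ^ d))).
  by rewrite leq_mul2r (leq_pexp2l _ r3) ?orbT.
have : (2 ^ d <= 5 ^ d)%N by case: d => // d; rewrite leq_exp2r.
have : (0 < 5 ^ d)%N by rewrite expn_gt0.
by move: (2 ^ d)%N (5 ^ d)%N => A B; lia.
Qed.

(** The fewer than j - r factors 5 of C(j, r) bound what C(n, j) can lose
    against C(n, r). *)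
Lemma dvdn_tail_term n r j : (r <= 3)%N -> (r + 4 <= j <= n)%N ->
  (5 ^ (r + logn 5 'C(n, r)).+1 %| 5 ^ j * 'C(n, j))%N.
Proof.
move=> r3 /andP[rj jn].
have Cpos m k : (k <= m)%N -> (0 < 'C(m, k))%N by rewrite bin_gt0.
have Cnj := Cpos _ _ jn.
rewrite pfactor_dvdn ?muln_gt0 ?expn_gt0 ?Cnj //.
rewrite lognM ?expn_gt0 // pfactorK //.
have lt_log : (logn 5 'C(j, r) < j - r)%N.
  rewrite -(@ltn_exp2l 5) //; apply: leq_ltn_trans (bin_lt_exp5 _ _ r3 rj).
  by apply: dvdn_leq; [apply: Cpos; lia | exact: pfactor_dvdnn].
have := congr1 (logn 5) (bin_mul_bin n j r ltac:(lia)).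
by rewrite !lognM ?Cpos //; lia.
Qed.

(** * The valuation of G_n *)

(** The term j = r of the expansion is 5^(r + v) times a Gaussian integer not
    divisible by 5, where v is the valuation of C(n, r); all others are
    divisible by 5^(r + v + 1). *)
Lemma gvp_G5 n r : (r = n %% 4)%N ->
  gvp 5 (G5 n) = (r + logn 5 'C(n, r))%:Z%:E.
Proof.
move=> rE.
have r3 : (r <= 3)%N by rewrite rE -ltnS ltn_mod.
have rn : (r <= n)%N by rewrite rE leq_mod.
have nE : n = (4 * (n %/ 4) + r)%N by rewrite rE mulnC -divn_eq.
set v := logn 5 _; pose e := (r + v)%N.
have Cpos : (0 < 'C(n, r))%N by rewrite bin_gt0.
have [|c co_c Cc] := @pfactor_coprime 5 'C(n, r) _ Cpos; first by [].
have co2 k : coprime (5 ^ k) (2 ^ n) by rewrite coprimeXl ?coprimeXr.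
have tail j : (j < n.+1)%N -> j != r ->
  gdvd (5 ^ e.+1) ((psum (n - j) * diag ^+ j) *+ (5 ^ j * 'C(n, j))).
  move=> jn jr; have [d4|/psum_eq0->] := boolP (4 %| n - j)%N; last first.
    by rewrite mul0r mul0rn /gdvd /= !dvdz0.
  have /dvdnP[q qE] := d4; apply/gdvd_mulrn/dvdn_tail_term => //.
  by lia.
pose P : gaussint := psum (n - r) * diag ^+ r.
have P5 : ~~ gdvd 5 P.
  apply/negP => /gdvd5_ev2; rewrite /P rmorphM rmorphXn /=.
  have -> : (n - r = 4 * (n %/ 4))%N by lia.
  apply/eqP; rewrite mulf_neq0 ?ev2_psum // expf_neq0 //.
have coefE : (5 ^ r * 'C(n, r) = 5 ^ e * c)%N.
  by rewrite Cc expnD -mulnA [(c * _)%N]mulnC.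
have dvd5e k : (k <= e.+1)%N ->
    gdvd (5 ^ k) (G5 n) = gdvd (5 ^ k) (P *+ (5 ^ e * c)).
  move=> ke; rewrite -(gdvd_Gauss _ _ (G5 n) (co2 k)) G5_expand.
  rewrite (bigD1 (Ordinal (rn : r < n.+1)%N)) //= coefE gdvd_addl //.
  apply: gdvd_sum => j jr; apply: gdvd_dvdn (tail j (ltn_ord j) jr).
  exact: dvdn_exp2l.
apply: gvp_eq => //; rewrite dvd5e ?leqnSn //.
  by apply: gdvd_mulrn; rewrite dvdn_mulr.
rewrite [(5 ^ e * c)%N]mulnC mulrnA expnSr gdvd_pmul2l ?expn_gt0 //.
by rewrite gdvd_Gauss.
Qed.

Lemma vp_nat p m : (0 < m)%N -> vp p m%:Z = (logn p m)%:Z%:E.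
Proof. by rewrite /vp; case: m. Qed.

Lemma logn_bin_ffact p n r : prime p -> (r < p)%N -> (r <= n)%N ->
  logn p 'C(n, r) = logn p (n ^_ r).
Proof.
move=> p_pr rp rn; rewrite -bin_ffact lognM ?bin_gt0 ?fact_gt0 //.
suff -> : logn p r`! = 0%N by rewrite addn0.
elim: r rp {rn} => [|r IHr] rp; first by rewrite fact0 logn1.
rewrite factS lognM ?fact_gt0 // IHr ?(ltnW rp) // addn0.
by rewrite lognE p_pr /= gtnNdvd.
Qed.

Theorem theorem9 (n : nat) (n_ge1 : (1 <= n)%N) :
  [/\ (n = 0 %[mod 4])%N -> gvp 5 (G5 n) = 0%E,
      (n = 1 %[mod 4])%N -> gvp 5 (G5 n) = (1%:E + vp 5 n%:Z)%E,
      (n = 2 %[mod 4])%N ->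
        gvp 5 (G5 n) = (2%:E + vp 5 n%:Z + vp 5 (n%:Z - 1))%E
    & (n = 3 %[mod 4])%N ->
        gvp 5 (G5 n)
        = (3%:E + vp 5 n%:Z + vp 5 (n%:Z - 1) + vp 5 (n%:Z - 2))%E]
  /\
  (forall (Q : int) (r : nat), (r <= 3)%N -> n%:Z = 4 * Q + r%:Z ->
     gvp 5 (G5 n) = ((r%:Z)%:E + vp 5 ('C(n, r)%:Z))%E).
Proof.
split; last first.
  move=> Q r r3 nE; have rE : (r = n %% 4)%N by lia.
  by rewrite (gvp_G5 _ _ rE) vp_nat ?bin_gt0 1?rE ?leq_mod.
split=> n4.
- by rewrite (gvp_G5 n 0) // bin0 logn1.
- by rewrite (gvp_G5 n 1) // bin1 vp_nat.
- have n2 : (2 <= n)%N by rewrite -[2%N]/(2 %% 4)%N -n4 leq_mod.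
  rewrite (gvp_G5 n 2) // logn_bin_ffact // subzn // !vp_nat ?subn_gt0 //.
  by rewrite ffactnSr ffactn1 lognM ?subn_gt0.
- have n3 : (3 <= n)%N by rewrite -[3%N]/(3 %% 4)%N -n4 leq_mod.
  rewrite (gvp_G5 n 3) // logn_bin_ffact // !subzn ?(ltnW n3) //.
  rewrite !vp_nat ?subn_gt0 //; try lia.
  by rewrite 2!ffactnSr ffactn1 !lognM ?muln_gt0 ?subn_gt0 //; lia.
Qed.
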